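(* Algorithm 2 (Ultrametric Multiplication, described in the context) requires $\mathcal{O}(n)$ floating-point operations to multiply an essentially ultrametric matrix $A\in\mathbb{R}^{n\times n}$, given in its tree representation $(V,E)$ constructed by Algorithm 1 (described in the context), by a vector $x\in\mathbb{R}^n$. That is, there is an absolute constant $C$ such that for every $n\ge 1$, every essentially ultrametric $A\in\mathbb{R}^{n\times n}$ and every $x\in\mathbb{R}^n$, Algorithm 2 run on the tree $(V,E)$ constructed by Algorithm 1 for $A$ and on $x$ uses at most $Cn$ floating-point operations to compute the product $Ax$.
   Context: A nonnegative (entrywise) symmetric matrix $A=[a_{ij}]\in\mathbb{R}^{n\times n}$ is called essentially ultrametric if $a_{ij}\ge\min\{a_{ik},a_{kj}\}$ for all $i,j,k$ with $i\neq j\neq k\neq i$ (pairwise distinct indices). No condition relates the diagonal entries to the off-diagonal entries. Algorithm 1 (Ultrametric Tree Construction). Input: an essentially ultrametric matrix $A=[a_{ij}]\in\mathbb{R}^{n\times n}$. Output: a directed graph $(V,E)$ (the tree representation of $A$), each vertex $u\in V$ carrying an index set $I(u)$ and a value $f(u)$. Initialize $V\gets\{r\}$, $E\gets\emptyset$, $I(r)\gets\{1,\ldots,n\}$, and call TreeRecursion($r$). The procedure TreeRecursion($u$) does the following. Set $i\gets\min I(u)$. - If $|I(u)|=1$: set $f(u)\gets a_{ii}$ and return. - Otherwise: set $f(u)\gets\min\{a_{ij}: j\in I(u)\setminus\{i\}\}$; create two new vertices $v,w$ and set $V\gets V\cup\{v,w\}$, $E\gets E\cup\{(u,v),(u,w)\}$;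 set $I(v)\gets\{j\in I(u): a_{ij}>f(u)\}\cup\{i\}$ and $I(w)\gets\{j\in I(u)\setminus\{i\}: a_{ij}=f(u)\}$; call TreeRecursion($v$), then TreeRecursion($w$). Algorithm 2 (Ultrametric Multiplication). Input: a tree $(V,E)$ with root $r$ constructed by Algorithm 1 for $A$ (together with the data $I(u)$, $f(u)$ for $u\in V$), and a vector $x\in\mathbb{R}^n$. Output: a vector $y\in\mathbb{R}^n$ (the product $y=Ax$). It assigns to each vertex $u$ additional values $s(u),t(u),p(u)$. It first calls PartialProduct($r,0$) and then TotalProduct($r,0$). - PartialProduct($u,z$): if $|I(u)|=1$, set $s(u)\gets x_i$ where $I(u)=\{i\}$; otherwise set $s(u)\gets\sum_{v\in V:(u,v)\in E}\text{PartialProduct}(v,f(u))$, the sum of the values returned by the recursive calls. Then set $t(u)\gets (f(u)-z)\,s(u)$ and return $s(u)$. - TotalProduct($u,q$): set $p(u)\gets q+t(u)$. If $|I(u)|=1$, set $y_i\gets p(u)$ where $I(u)=\{i\}$; otherwise call TotalProduct($v,p(u)$) for every $v\in V$ with $(u,v)\in E$. Cost convention: floating-point operations are elementary arithmetic operations on (and comparisons between) real numbers. The cost of constructing the tree by Algorithm 1 is not counted. *)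

(* Defs.v *)
From mathcomp Require Import all_boot all_order all_algebra.
From mathcomp Require Import reals.

Set Implicit Arguments.
Unset Strict Implicit.
Unset Printing Implicit Defensive.

Import Order.TTheory GRing.Theory Num.Theory.
Local Open Scope ring_scope.

Definition ess_ultrametric (R : realType) (n : nat) (A : 'M[R]_n) : Prop :=
  [/\ forall i j, 0 <= A i j,
      forall i j, A i j = A j i
    & forall i j k, i != j -> j != k -> k != i ->
        Num.min (A i k) (A k j) <= A i j].

(* A vertex u is identified with the subtree rooted at u, and the edges leaving
   it are the links to its immediate subtrees. A [Leaf i d] is a vertex with
   I(u) = {i}; a [Node J d v w] is a vertex with I(u) = J, not a singleton.
   The values attached to u are in d : D; for the tree representation of a
   matrix, D = R and d = f(u). *)
Inductive tree (n : nat) (D : Type) : Type :=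
| Leaf of 'I_n & D
| Node of {set 'I_n} & D & tree n D & tree n D.

Arguments Leaf {n D}.
Arguments Node {n D}.

(* min {F j : j \in J}, or None if J is empty. *)
Definition min_over d (S : orderType d) (T : finType) (J : {set T})
    (F : T -> S) : option S :=
  omap F [pick i in J | [forall j in J, (F i <= F j)%O]].

(* The index sets shrink strictly along the edges, so recursion depth #|J| is
   enough; None means that the depth k is exhausted (or that J is empty). *)
Fixpoint tree_recursion (R : realType) (n : nat) (A : 'M[R]_n) (k : nat)
    (J : {set 'I_n}) : option (tree n R) :=
  if k isn't k'.+1 then None else
  if min_over J id isn't Some i then None else
  if #|J| == 1%N then Some (Leaf i (A i i)) else
  if min_over (J :\ i) (fun j => A i j) isn't Some fu then None else
  let Iv := [set j in J | fu < A i j] :|: [set i] in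
  let Iw := [set j in J :\ i | A i j == fu] in
  if tree_recursion A k' Iv isn't Some v then None else
  if tree_recursion A k' Iw isn't Some w then None else
  Some (Node J fu v w).

Definition ultrametric_tree (R : realType) (n : nat) (A : 'M[R]_n) :
  option (tree n R) := tree_recursion A n [set: 'I_n].

(* Computations with a count of the floating-point operations performed.
   Programs may operate on reals only through fadd, fsub and fmul; the
   multiplication algorithm compares no reals and needs no other operation. *)
Record counted (T : Type) : Type := Counted { value : T; flops : nat }.

Definition ret (T : Type) (a : T) : counted T := Counted a 0.

Definition bind (T U : Type) (m : counted T) (k : T -> counted U) : counted U :=
  Counted (value (k (value m))) (flops m + flops (k (value m))).

Notation "'let*' p ':=' m 'in' k" := (bind m (fun p => k))
  (at level 200, p pattern, m at level 200, k at level 200).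

Definition fadd (R : realType) (a b : R) : counted R := Counted (a + b) 1.
Definition fsub (R : realType) (a b : R) : counted R := Counted (a - b) 1.
Definition fmul (R : realType) (a b : R) : counted R := Counted (a * b) 1.

Record vertex_data (R : realType) : Type :=
  VertexData { f_of : R; s_of : R; t_of : R }.

(* Returns s(u), together with the tree in which s and t have been stored. *)
Fixpoint partial_product (R : realType) (n : nat) (x : 'cV[R]_n)
    (u : tree n R) (z : R) : counted (R * tree n (vertex_data R)) :=
  match u with
  | Leaf i f =>
      let s := x i 0 in
      let* d := fsub f z in
      let* t := fmul d s in
      ret (s, Leaf i (VertexData f s t))
  | Node J f v w =>
      let* (sv, v') := partial_product x v f in
      let* (sw, w') := partial_product x w f in
      let* s := fadd sv sw in
      let* d := fsub f z in
      let* t := fmul d s in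
      ret (s, Node J (VertexData f s t) v' w')
  end.

Definition set_entry (R : realType) (n : nat) (y : 'cV[R]_n) (i : 'I_n)
    (a : R) : 'cV[R]_n :=
  \col_j (if j == i then a else y j 0).

(* The output vector y is threaded through the calls as mutable state. *)
Fixpoint total_product (R : realType) (n : nat) (u : tree n (vertex_data R))
    (q : R) (y : 'cV[R]_n) : counted 'cV[R]_n :=
  match u with
  | Leaf i d =>
      let* p := fadd q (t_of d) in
      ret (set_entry y i p)
  | Node _ d v w =>
      let* p := fadd q (t_of d) in
      let* y' := total_product v p y in
      total_product w p y'
  end.

Definition ultrametric_mul (R : realType) (n : nat) (r : tree n R)
    (x : 'cV[R]_n) : counted 'cV[R]_n :=
  let* (_, r') := partial_product x r 0 in
  total_product r' 0 0.

(* Main.v *)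
Require Import Defs.
From mathcomp Require Import all_boot all_order all_algebra.
From mathcomp Require Import reals.
From mathcomp Require Import zify ring.

(** Let [f] be the least off-diagonal entry, within [J], of the row of the least
    index [i] of [J].  The tree splits [J] into the indices where that row
    attains [f], and the others together with [i].  The ultrametric inequality
    makes [A] constant, equal to [f], on the off-diagonal block between the two
    parts ([cross_block_constant]); so [A] restricted to [J] is the matrix with
    all entries [f], corrected on the two diagonal blocks alone.  [block_tree]
    records this structure.

    Correctness follows by telescoping.  The subtree over [J], entered with the
    level [z] of its parent, contributes to the output at [j \in J] the number
    [\sum_(l in J) (A j l - z) * x l]: the vertex itself adds [f - z] times the
    sum of [x] over [J], which settles the columns outside the part containing
    [j], and the recursive call replaces [f] by the true entry on the columns
    inside.  At the root, [z = 0] and the sum is the product [A *m x].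

    For the cost, the parts are nonempty and disjoint, so the tree is a full
    binary tree with one leaf per index: [n] leaves and [n - 1] inner vertices.
    A leaf costs 3 operations and an inner vertex 4, for a total of [7 n - 4]. *)

Set Implicit Arguments.
Unset Strict Implicit.
Unset Printing Implicit Defensive.

Import Order.TTheory GRing.Theory Num.Theory.
Local Open Scope ring_scope.

(** * The structure of the tree *)

Lemma min_over_attained d (S : orderType d) (T : finType) (J : {set T})
    (F : T -> S) :
  J != set0 ->
  exists2 i, i \in J &
    min_over J F = Some (F i) /\ forall j, j \in J -> (F i <= F j)%O.
Proof.
move=> /set0Pn [i0 i0J]; rewrite /min_over.
case: pickP => [i /andP[iJ /forall_inP minF]|none]; first by exists i.
case: (arg_minP F i0J) => i iJ minF.
have /negP[] := negbT (none i).
by apply/andP; split=> //; apply/forall_inP => j /minF.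
Qed.

(** Both the correctness and the cost of the multiplication depend on this block
    structure alone: forgetting how the two parts were selected from the row of
    the least index leaves an induction over the tree. *)
Inductive block_tree (R : realType) (n : nat) (A : 'M[R]_n) :
    {set 'I_n} -> tree n R -> Prop :=
| BlockLeaf i : block_tree A [set i] (Leaf i (A i i))
| BlockNode (K L : {set 'I_n}) (f : R) v w :
    [disjoint K & L] ->
    (forall a b, a \in K -> b \in L -> A a b = f /\ A b a = f) ->
    block_tree A K v -> block_tree A L w ->
    block_tree A (K :|: L) (Node (K :|: L) f v w).

(** In an ultrametric triangle the two smallest entries agree; [A i b] is less
    than [A i a], so it is one of those two and the other is [A a b]. *)
Lemma cross_block_constant (R : realType) (n : nat) (A : 'M[R]_n)
    (i a b : 'I_n) :
  ess_ultrametric A -> i != a -> i != b -> A i b < A i a -> A a b = A i b.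
Proof.
move=> [_ symA ultraA] i_a i_b lt_ba.
have a_b : a != b by apply: contraTneq lt_ba => ->; rewrite ltxx.
have := ultraA a b i a_b; rewrite eq_sym => /(_ i_b i_a).
have := ultraA i b a i_b; rewrite eq_sym => /(_ a_b).
rewrite eq_sym => /(_ i_a).
rewrite (symA a i) !ge_min [A i a <= A i b]leNgt lt_ba /= => le_ab.
case/orP => [le_ia|le_ib]; last by apply/le_anti/andP.
by move: (lt_le_trans lt_ba le_ia); rewrite ltNge le_ab.
Qed.

Lemma card_disjointU (T : finType) (K L : {set T}) :
  [disjoint K & L] -> #|K :|: L| = (#|K| + #|L|)%N.
Proof. by move=> dKL; apply/eqP; rewrite leq_card_setU. Qed.

(** The least index [i] goes to one part and a minimizer of its row to the
    other, so both parts are nonempty, hence both are strictly smaller than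
    [J]; this is why depth [#|J|] suffices. *)
Lemma tree_recursion_block_tree (R : realType) (n : nat) (A : 'M[R]_n)
    (k : nat) (J : {set 'I_n}) :
  ess_ultrametric A -> J != set0 -> (#|J| <= k)%N ->
  exists2 r, tree_recursion A k J = Some r & block_tree A J r.
Proof.
move=> ultraA; elim: k J => [|k IHk] J J0 leJk.
  by move: J0; rewrite -card_gt0 ltnNge leJk.
have [i iJ [/= -> _]] := min_over_attained id J0.
case: eqP => [/eqP/cards1P [a Ja]|/eqP J1].
  move: iJ; rewrite Ja in_set1 => /eqP ->.
  by exists (Leaf a (A a a)) => //; apply: BlockLeaf.
have Ji0 : J :\ i != set0.
  by move: J1; rewrite (cardsD1 i) iJ add1n eqSS cards_eq0.
have [m mJ [-> minA]] := min_over_attained (fun j => A i j) Ji0.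
set K := [set j in J | _] :|: [set i]; set L := [set j in _ | _].
have iK : i \in K by rewrite !inE eqxx orbT.
have mL : m \in L by rewrite inE mJ eqxx.
have dKL : [disjoint K & L].
  rewrite -setI_eq0; apply/eqP/setP => j; rewrite !inE.
  have [->|_] := eqVneq j i; first by rewrite andbF.
  by rewrite orbF; case: ltgtP; rewrite ?andbF.
have JE : J = K :|: L.
  apply/setP => j; rewrite !inE.
  have [->|ji] := eqVneq j i; first by rewrite iJ orbT.
  rewrite orbF; case jJ: (j \in J) => //=.
  by have := minA j; rewrite !inE ji jJ => /(_ isT); case: ltgtP.
have cJ : #|J| = (#|K| + #|L|)%N by rewrite -card_disjointU // -JE.
have cK : (0 < #|K|)%N by rewrite card_gt0; apply/set0Pn; exists i.
have cL : (0 < #|L|)%N by rewrite card_gt0; apply/set0Pn; exists m.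
have [||v -> treev] := IHk K; [by rewrite -card_gt0 | by lia | ].
have [||w -> treew] := IHk L; [by rewrite -card_gt0 | by lia | ].
exists (Node J (A i m) v w) => //.
rewrite JE; apply: BlockNode => // a b.
rewrite !inE => aK /andP[/andP[bi _] /eqP Aib].
suff Aab : A a b = A i m by split=> //; case: ultraA => _ symA _; rewrite symA.
have [->//|ai] := eqVneq a i.
move: aK; rewrite (negPf ai) orbF => /andP[_ lt_ia].
by rewrite -Aib; apply: cross_block_constant; rewrite // 1?eq_sym // Aib.
Qed.

(** * The values computed *)

Lemma sum_disjointU (V : nmodType) (T : finType) (K L : {set T}) (F : T -> V) :
  [disjoint K & L] ->
  \sum_(l in K :|: L) F l = \sum_(l in K) F l + \sum_(l in L) F l.
Proof. by move=> dKL; rewrite -bigU //; apply: eq_bigl => l; rewrite !inE. Qed.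

Lemma partial_product_sum (R : realType) (n : nat) (A : 'M[R]_n)
    (x : 'cV[R]_n) J u z :
  block_tree A J u -> (value (partial_product x u z)).1 = \sum_(l in J) x l 0.
Proof.
move=> treeu; elim: treeu z => [i|K L f v w dKL _ _ IHv _ IHw] z /=.
  by rewrite big_set1.
rewrite sum_disjointU //; move: (IHv f) (IHw f).
case: (value (partial_product x v f)) => sv v' /= <-.
by case: (value (partial_product x w f)) => sw w' /= <-.
Qed.

(** For [j] in one part of a vertex, the columns of the other part reach their
    final value [f] at this vertex, and those of its own part are corrected from
    [f] to their true value below it; hence the generalization over the level [z]
    and the accumulator [q].  Entries outside [J] survive, so the second
    recursive call does not spoil what the first one wrote. *)
Lemma total_product_telescope (R : realType) (n : nat) (A : 'M[R]_n)
    (x : 'cV[R]_n) J u z q y j :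
  block_tree A J u ->
  value (total_product (value (partial_product x u z)).2 q y) j 0 =
    if j \in J then q + \sum_(l in J) (A j l - z) * x l 0 else y j 0.
Proof.
move=> treeu.
elim: treeu z q y => [i|K L f v w dKL crossA treev IHv treew IHw] z q y /=.
  by rewrite mxE in_set1; case: eqP => // ->; rewrite big_set1.
have sumv := partial_product_sum x f treev.
have sumw := partial_product_sum x f treew.
move: (IHv f) (IHw f) sumv sumw => {IHv IHw}.
case: (value (partial_product x v f)) => sv v' /=.
case: (value (partial_product x w f)) => sw w' /= IHv IHw -> ->.
rewrite IHw IHv in_setU !sum_disjointU //.
(* Passing from level [z] to level [f] on the two parts costs two terms whose
   sum is the value [t(u)] added at this vertex. *)
have shift (B : {set 'I_n}) :
    \sum_(l in B) (A j l - z) * x l 0 =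
      (f - z) * \sum_(l in B) x l 0 + \sum_(l in B) (A j l - f) * x l 0.
  by rewrite mulr_sumr -big_split /=; apply: eq_bigr => l _; ring.
rewrite !shift.
have [jL|jL] := boolP (j \in L); last case: ifP => //= jK.
- rewrite orbT [X in _ = _ + (_ + X + _)]big1 => [|l lK]; first by ring.
  by have [_ ->] := crossA l j lK jL; rewrite subrr mul0r.
- rewrite [X in _ = _ + (_ + (_ + X))]big1 => [|l lL]; first by ring.
  by have [-> _] := crossA j l jK lL; rewrite subrr mul0r.
Qed.

(** * The number of operations *)

(** With [#|J|] leaves at 2 operations and [#|J| - 1] inner vertices at 3. *)
Lemma partial_product_flops (R : realType) (n : nat) (A : 'M[R]_n)
    (x : 'cV[R]_n) J u z :
  block_tree A J u -> (flops (partial_product x u z) + 3 = 5 * #|J|)%N.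
Proof.
move=> treeu; elim: treeu z => [i|K L f v w dKL _ _ IHv _ IHw] z /=.
  by rewrite cards1.
rewrite card_disjointU //; move: (IHv f) (IHw f).
case: (partial_product x v f) => [[sv v'] cv].
by case: (partial_product x w f) => [[sw w'] cw] /=; lia.
Qed.

(** One addition at each of the [2 * #|J| - 1] vertices. *)
Lemma total_product_flops (R : realType) (n : nat) (A : 'M[R]_n)
    (x : 'cV[R]_n) J u z q y :
  block_tree A J u ->
  (flops (total_product (value (partial_product x u z)).2 q y) + 1 =
     2 * #|J|)%N.
Proof.
move=> treeu; elim: treeu z q y => [i|K L f v w dKL _ _ IHv _ IHw] z q y /=.
  by rewrite cards1.
rewrite card_disjointU //; move: (IHv f) (IHw f) => {IHv IHw}.
case: (value (partial_product x v f)) => sv v' /=.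
case: (value (partial_product x w f)) => sw w' /= IHv IHw.
set p := q + _; have := IHv p y; have := IHw p (value (total_product v' p y)).
by lia.
Qed.

Theorem corollary3p2 :
  exists C : nat,
    forall (R : realType) (n : nat) (A : 'M[R]_n) (x : 'cV[R]_n),
      (1 <= n)%N ->
      ess_ultrametric A ->
      exists2 r : tree n R,
        ultrametric_tree A = Some r &
        value (ultrametric_mul r x) = A *m x
        /\ (flops (ultrametric_mul r x) <= C * n)%N.
Proof.
exists 7 => R n A x n_gt0 ultraA.
have [||r treeE blockr] := tree_recursion_block_tree (k := n) (J := setT) ultraA.
- by rewrite -card_gt0 cardsT card_ord.
- by rewrite cardsT card_ord.
exists r => //.
have val_r j := total_product_telescope x 0 0 0 j blockr.
have cost_partial := partial_product_flops x 0 blockr.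
have cost_total := total_product_flops x 0 0 0 blockr.
move: val_r cost_partial cost_total; rewrite cardsT card_ord /ultrametric_mul /=.
case: (partial_product x r 0) => [[s r'] c] /= val_r cost_partial cost_total.
split; last by lia.
apply/colP => j; rewrite val_r in_setT add0r mxE.
by apply: eq_big => [l|l _]; rewrite ?in_setT ?subr0.
Qed.
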